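(* For $n\ge0$, the coefficient $c(\rho^{(3)};4n)$ is odd if and only if $n=2k(3k+1)$ for some integer $k$ (positive, negative or zero).
   Context: $(a;q)_n=\prod_{k=0}^{n-1}(1-aq^k)$. For a formal power series $g(q)=\sum_{n\ge0}c(n)q^n$, $c(g;n):=c(n)$. The third order mock theta function is $$\rho^{(3)}(q)=\sum_{n=0}^\infty\frac{q^{2n(n+1)}(q;q^2)_{n+1}}{(q^3;q^6)_{n+1}}.$$ *)

(* Defs.v *)
From HB Require Import structures.
From mathcomp Require Import all_boot all_order all_algebra.

Set Implicit Arguments.
Unset Strict Implicit.
Unset Printing Implicit Defensive.

Import GRing.Theory.
Local Open Scope ring_scope.

Definition qpoch (R : comNzRingType) (a q : R) (n : nat) : R :=
  \prod_(k < n) (1 - a * q ^+ k).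

(* A formal power series is represented by its sequence of coefficients, so    *)
(* that c(g;n) is the application g n.                                         *)
Definition fps (R : Type) := nat -> R.

Section FormalPowerSeries.
Variable R : comUnitRingType.
Implicit Types (f g : fps R) (F : nat -> fps R).

Definition fps_of_poly (p : {poly R}) : fps R := fun n => p`_n.

Definition fps_mul f g : fps R := fun n => \sum_(i < n.+1) f i * g (n - i)%N.

(* [:: g 0; ...; g n] where f * g = 1, solving for g m one m at a time.        *)
Fixpoint fps_inv_seq f n : seq R :=
  if n is m.+1 then
    let s := fps_inv_seq f m in
    rcons s (- ((f 0%N)^-1 * \sum_(i < m.+1) f i.+1 * s`_(m - i)%N))
  else [:: (f 0%N)^-1].

(* The inverse of f when f 0 is a unit (see fps_mulV).                         *)
Definition fps_inv f : fps R := fun n => (fps_inv_seq f n)`_n.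

(* The infinite sum of the F k, for families such that F k has order >= k; it  *)
(* is then the limit of the partial sums in the q-adic topology (see           *)
(* fps_sum_limit).                                                             *)
Definition fps_sum F : fps R := fun n => \sum_(k < n.+1) F k n.

Lemma fps_sum_limit F :
    (forall k n, (n < k)%N -> F k n = 0) ->
  forall n N, (n < N)%N -> \sum_(k < N) F k n = fps_sum F n.
Proof.
move=> F0 n N ltnN; rewrite /fps_sum.
rewrite (big_ord_widen N (fun k => F k n) ltnN).
rewrite [LHS](bigID (fun k : 'I_N => k < n.+1)%N) /=.
by rewrite [X in _ + X]big1 ?addr0 // => k; rewrite -leqNgt; apply: F0.
Qed.

Lemma size_fps_inv_seq f n : size (fps_inv_seq f n) = n.+1.
Proof. by elim: n => //= n IHn; rewrite size_rcons IHn. Qed.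

Lemma nth_fps_inv_seq f n i : (i <= n)%N -> (fps_inv_seq f n)`_i = fps_inv f i.
Proof.
elim: n => [|n IHn]; first by case: i.
rewrite leq_eqVlt => /predU1P[-> //|lt_in] /=.
by rewrite nth_rcons size_fps_inv_seq lt_in IHn.
Qed.

Lemma fps_mulV f : f 0%N \is a GRing.unit ->
  forall n, fps_mul f (fps_inv f) n = (n == 0%N)%:R.
Proof.
move=> f0 [|n]; rewrite /fps_mul big_ord_recl /= subn0.
  by rewrite big_ord0 addr0 /fps_inv /= divrr.
rewrite {1}/fps_inv /= nth_rcons size_fps_inv_seq ltnn eqxx.
rewrite mulrN mulVKr // addrC; apply/eqP; rewrite subr_eq0; apply/eqP.
by apply: eq_bigr => i _; rewrite nth_fps_inv_seq ?leq_subr.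
Qed.

End FormalPowerSeries.

(* The variable q is 'X. The inverse exists by rho3_denom_unit, and the sum     *)
(* converges by rho3_term_order.                                               *)
Definition rho3_term (n : nat) : fps int :=
  fps_mul (fps_of_poly ('X^(2 * n * n.+1) * qpoch 'X 'X^2 n.+1))
          (fps_inv (fps_of_poly (qpoch 'X^3 'X^6 n.+1))).

Definition rho3 : fps int := fps_sum rho3_term.

Lemma rho3_denom_unit n :
  fps_of_poly (qpoch 'X^3 'X^6 n.+1 : {poly int}) 0 \is a GRing.unit.
Proof.
suff -> : fps_of_poly (qpoch 'X^3 'X^6 n.+1 : {poly int}) 0 = 1 by rewrite unitr1.
rewrite /fps_of_poly -horner_coef0 horner_prod big1 // => k _.
by rewrite hornerD hornerN hornerM hornerXn expr0n /= mul0r hornerC subr0.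
Qed.

Lemma rho3_term_order n m : (m < n)%N -> rho3_term n m = 0.
Proof.
move=> lt_mn; apply: big1 => i _; rewrite /fps_of_poly coefXnM ifT ?mul0r //.
have le_im : (i <= m)%N by rewrite -ltnS.
apply: leq_ltn_trans le_im (leq_trans lt_mn _).
by rewrite mulnC mulnA leq_pmull // muln_gt0.
Qed.

(* Main.v *)
Require Import Defs.
From HB Require Import structures.
From mathcomp Require Import all_boot all_order all_algebra.
From mathcomp Require Import ring zify.
From mathcomp Require Import qpoly.

Set Implicit Arguments.
Unset Strict Implicit.
Unset Printing Implicit Defensive.

Import GRing.Theory.
Local Open Scope ring_scope.

(** The proof has three layers: an exact series identity, its reduction modulo
    2, and a parity count of lattice points.

    Write Phi for the infinite product (q^2; q^2), and x = q^(2n+1) in the n-th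
    term of a sum. Since (1 - x)/(1 - x^3) = 1/(1 + x + x^2), each term of rho
    is a monomial over a product of symmetric quadratic factors. Expanding that
    product into partial fractions is a Bailey pair
    ([symmetric_product_bailey_pair]), and Bailey's lemma ([bailey_lemma_nil])
    turns the series into Watson's formula
      Phi rho = sum over n >= 0 of (-1)^n q^(3n(n+1)) (1 - x^2)/(1 + x + x^2).
    The same lemma applied to the unit Bailey pair gives Euler's expansion of
    Phi, with exponents k(3k+1) for k in Z.

    Modulo 2, (1 - x^2)/(1 + x + x^2) is the sum of x^m over m = 0 and the m
    prime to 3. Multiplying Watson's formula by Phi once more, the coefficient
    of q^(4M) in Phi^2 rho counts, modulo 2, the triples (k, n, m) with
      k(3k+1) + 3n(n+1) + (2n+1)m = 4M,  n >= 0,  m = 0 or 3 does not divide m.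
    - The triples with m > 0 are even in number ([even_positive_triples]): a
      linear change of variables sends them to the integer points (u, t, g) of
      the indefinite form u^2 - t^2 + 2g^2 = 24M + 5, with u and t divisible by
      3, in the cone t < g, 0 < u + t. Every sign change preserves the form, and
      at each point some sign change stays in the cone. Choosing one
      consistently gives an involution, and it has no fixed point because the
      congruences modulo 3 and 8 forbid zero coordinates ([cone_flipP]).
    - The triples with m = 0 correspond to the pairs (k, l) in Z^2 with
      2k(3k+1) + 8l(3l+1) = 4M ([zero_triples]).

    As Phi^2 is the sum of q^(2k(3k+1)) modulo 2, this says that the series of
    the coefficients of q^(4M) in rho and the series of q^(8l(3l+1)) have the
    same product with Phi^2, hence are equal. Finally l -> l(3l+1) is injective,
    so no cancellation occurs in the latter.

    Power series are handled in the truncated ring F[X]/(X^K), in which the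
    variable q is nilpotent: infinite sums and products become finite, and
    every 1 - q a is invertible. The series identities are stated for an
    arbitrary nilpotent q. *)

(** * Preliminaries *)

Lemma qpochS (R : comNzRingType) (a q : R) n :
  qpoch a q n.+1 = qpoch a q n * (1 - a * q ^+ n).
Proof. by rewrite /qpoch big_ord_recr. Qed.

Lemma rmorph_qpoch (R S : comNzRingType) (f : {rmorphism R -> S}) a q n :
  f (qpoch a q n) = qpoch (f a) (f q) n.
Proof.
rewrite rmorph_prod; apply: eq_bigr => k _.
by rewrite rmorphB rmorph1 rmorphM rmorphXn.
Qed.

Lemma unitr_1subX (R : comUnitRingType) (x : R) m :
  x ^+ m = 0 -> 1 - x \is a GRing.unit.
Proof.
move=> xm0; apply/unitrPr; exists (\sum_(i < m) x ^+ i).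
by have := subrX1 x m; rewrite xm0 sub0r -(opprB 1 x) mulNr => /oppr_inj.
Qed.

Lemma unitr_1DXDX2 (R : comUnitRingType) (x : R) m :
  x ^+ m = 0 -> 1 + x + x ^+ 2 \is a GRing.unit.
Proof.
move=> xm0; have -> : 1 + x + x ^+ 2 = 1 - x * - (1 + x) by ring.
by rewrite (unitr_1subX (m := m)) // exprMn xm0 mul0r.
Qed.

Lemma sum_ord_trunc (V : nmodType) (F : nat -> V) K L : (K <= L)%N ->
    (forall n, (K <= n)%N -> F n = 0) ->
  \sum_(n < L) F n = \sum_(n < K) F n.
Proof.
move=> leKL F0; rewrite (big_ord_widen L F leKL) [LHS](bigID (fun n : 'I_L => n < K)%N) /=.
by rewrite [X in _ + X]big1 ?addr0 // => n; rewrite -leqNgt; apply: F0.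
Qed.

(** * Bailey pairs relative to a = q *)

Section Bailey.

Variables (R : comUnitRingType) (q : R).
Hypothesis q_unit : forall n, qpoch q q n \is a GRing.unit.

Local Notation iq n := (qpoch q q n)^-1.

Lemma unit_1subXS n : 1 - q ^+ n.+1 \is a GRing.unit.
Proof. by have := q_unit n.+1; rewrite qpochS -exprS unitrM => /andP[]. Qed.

Lemma iqS n : iq n = (1 - q ^+ n.+1) * iq n.+1.
Proof.
by rewrite qpochS -exprS invrM ?unit_1subXS // mulrA divrr ?unit_1subXS // mul1r.
Qed.

Let durfee_sum l a :=
  \sum_(j < l.+1) q ^+ (j * (j + a)) * iq (l - j) * iq j * iq (j + a).

(** The splitting 1 - q^(l+1) = q^j (1 - q^(l+1-j)) + (1 - q^j) lowers l-j or j
    by one; after shifting j in the second half, the two halves recombine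
    because (1 - q^(j+a+1)) + q^(j+a+1) = 1. *)
Let durfee_sumS l a :
  (1 - q ^+ l.+1) * durfee_sum l.+1 a = durfee_sum l a.+1.
Proof.
pose t j := q ^+ (j * (j + a)) * iq (l.+1 - j) * iq j * iq (j + a).
pose A j := q ^+ j * (1 - q ^+ (l.+1 - j)) * t j.
pose B j := (1 - q ^+ j) * t j.
have -> : (1 - q ^+ l.+1) * durfee_sum l.+1 a = \sum_(j < l.+2) A j + \sum_(j < l.+2) B j.
  rewrite -big_split mulr_sumr; apply: eq_bigr => -[j /= ltj] _.
  rewrite -(subnKC (ltj : j <= l.+1)%N) exprD /A /B /t subnKC //.
  by ring.
rewrite big_ord_recr /= {2}/A subnn expr0 subrr mulr0 mul0r addr0.
have B0 : B 0%N = 0 by rewrite /B expr0 subrr mul0r.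
rewrite [X in _ + X]big_ord_recl B0 add0r -big_split.
apply: eq_bigr => -[j /= ltj] _; rewrite /A /B /t /bump add1n subSS !addSn addnS.
rewrite (subSn (ltj : j <= l)%N) (iqS (l - j)) (iqS j) (iqS (j + a)).
have -> : (j.+1 * (j + a).+1 = j * (j + a).+1 + (j + a).+1)%N by ring.
rewrite mulnS !exprD [q ^+ _.+1]exprS [q ^+ (j + a).+1]exprS.
by ring.
Qed.

(** A finite form of the Durfee rectangle identity, the limiting case of
    q-Chu-Vandermonde; it is the only summation behind Bailey's lemma. *)
Lemma durfee_rectangle l a :
  \sum_(j < l.+1) q ^+ (j * (j + a)) * iq (l - j) * iq j * iq (j + a)
    = iq l * iq (l + a).
Proof.
rewrite -/(durfee_sum l a); elim: l a => [|l IHl] a.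
  by rewrite /durfee_sum big_ord1 subnn mul0n expr0 mul1r /qpoch big_ord0 invr1 !mul1r.
apply: (mulrI (unit_1subXS l)).
by rewrite durfee_sumS IHl mulrA -iqS addSnnS.
Qed.

(** The Bailey relation with a = q, without the factor (q; q)_1 which the usual
    normalization of the second Pochhammer symbol introduces. *)
Definition bailey_pair (alpha beta : nat -> R) :=
  forall N, beta N = \sum_(n < N.+1) alpha n * iq (N - n) * iq (N + n).+1.

(** After exchanging the sums, the inner one is a Durfee rectangle of width
    2n+1. *)
Lemma bailey_lemma_fin (alpha beta : nat -> R) L : bailey_pair alpha beta ->
  \sum_(N < L.+1) q ^+ (N * N.+1) * iq (L - N) * beta N
  = \sum_(n < L.+1) q ^+ (n * n.+1) * alpha n * iq (L - n) * iq (L + n).+1.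
Proof.
move=> ab.
pose f N n := q ^+ (N * N.+1) * iq (L - N) * alpha n * iq (N - n) * iq (N + n).+1.
transitivity (\sum_(N < L.+1) \sum_(n < L.+1 | (n <= N)%N) f N n).
  apply: eq_bigr => -[N ltN] _ /=; rewrite ab mulr_sumr.
  rewrite (big_ord_widen L.+1 (fun n => q ^+ (N * N.+1) * iq (L - N) *
    (alpha n * iq (N - n) * iq (N + n).+1))) //.
  by apply: eq_bigr => n _; rewrite /f; ring.
rewrite (exchange_big_dep predT) //=; apply: eq_bigr => -[n ltn] _ /=.
rewrite -(big_geq_mkord _ _ (fun=> true) (f^~ n)) -{1}[n]add0n big_addn big_mkord subSn //.
transitivity (q ^+ (n * n.+1) * alpha n * \sum_(j < (L - n).+1)
   q ^+ (j * (j + (n + n).+1)) * iq (L - n - j) * iq j * iq (j + (n + n).+1)).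
  rewrite mulr_sumr; apply: eq_bigr => -[j /= ltj] _; rewrite /f addnK.
  have -> : ((j + n) * (j + n).+1 = n * n.+1 + j * (j + (n + n).+1))%N by ring.
  rewrite exprD (addnC j n) subnDA (_ : (n + j + n).+1 = j + (n + n).+1)%N; last by ring.
  by ring.
rewrite durfee_rectangle mulrA; congr (_ * (qpoch _ _ _)^-1).
by move: ltn; rewrite ltnS; lia.
Qed.

(** The sum is indefinitely summable: after multiplication by 1 - q^(N+1) its
    partial sums are closed forms (the very-well-poised evaluation at a = q),
    and the last one cancels the remaining term. *)
Lemma unit_bailey_pair :
  bailey_pair (fun n => (-1) ^+ n * q ^+ 'C(n, 2) * (1 - q ^+ n.*2.+1))
              (fun N => (N == 0%N)%:R).
Proof.
case=> [|N]; rewrite /bailey_pair.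
  rewrite big_ord1 subnn addn0 double0 bin0n /qpoch big_ord0 invr1 big_ord1 /=.
  by rewrite !expr0 !mulr1 !mul1r !expr1 divrr // (unit_1subXS 0).
pose t n := (-1) ^+ n * q ^+ 'C(n, 2) * (1 - q ^+ n.*2.+1) * iq (N.+1 - n) * iq (N.+1 + n).+1.
have partial m : (m <= N)%N ->
    (1 - q ^+ N.+1) * \sum_(n < m.+1) t n
    = (-1) ^+ m * q ^+ 'C(m.+1, 2) * (1 - q ^+ m.+1) * iq (N - m) * iq (N.+1 + m).+1.
  elim: m => [|m IHm] ltmN.
    rewrite big_ord1 /t /= !expr0 !subn0 addn0 (iqS N); change (nat_of_ord ord0) with 0%N.
    by rewrite double0; ring.
  rewrite big_ord_recr /= mulrDr IHm 1?ltnW // /t.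
  rewrite -{1}(subnSK ltmN) (iqS (N - m.+1)) !addnS (iqS (N.+1 + m).+1) subSS.
  rewrite (subnSK ltmN) !(binS _ 1) !bin1.
  have -> : q ^+ N.+1 = q ^+ m.+1 * q ^+ (N - m) by rewrite -exprD; congr (_ ^+ _); lia.
  have -> : q ^+ (N.+1 + m).+2 = q ^+ m.+1 * q ^+ m.+1 * q ^+ (N - m) * q.
    by rewrite -!exprD -exprSr; congr (_ ^+ _); lia.
  have -> : q ^+ m.+1.*2.+1 = q ^+ m.+1 * q ^+ m.+1 * q.
    by rewrite -!exprD -exprSr; congr (_ ^+ _); lia.
  rewrite !exprD (exprSr q m.+1) (exprS (-1)).
  by ring.
apply: (mulrI (unit_1subXS N)); rewrite mulr0 big_ord_recr /= mulrDr (partial N) //.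
rewrite /t !subnn [qpoch q q 0]/qpoch big_ord0 invr1 !addnS (iqS (N.+1 + N).+1) (exprS (-1)).
have -> : (N.+1 + N).+2 = N.+1.*2.+1 by rewrite -addnn addnS.
by ring.
Qed.

(** The limit L -> oo of the finite lemma: for nilpotent q the Pochhammer symbol
    is constant from index K on, and stands for the infinite product. *)
Lemma bailey_lemma_nil K (alpha beta : nat -> R) :
    q ^+ K = 0 -> bailey_pair alpha beta ->
  qpoch q q K * (\sum_(N < K) q ^+ (N * N.+1) * beta N)
  = \sum_(n < K) q ^+ (n * n.+1) * alpha n.
Proof.
move=> qK0 ab.
have expK n : (K <= n)%N -> q ^+ n = 0.
  by move=> leKn; rewrite -(subnK leKn) exprD qK0 mulr0.
have qpochK n : (K <= n)%N -> qpoch q q n = qpoch q q K.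
  elim: n => [|n IHn]; first by rewrite leqn0 => /eqP->.
  rewrite leq_eqVlt => /predU1P[<- //|leKn].
  by rewrite qpochS -exprS expK ?subr0 ?mulr1 ?IHn // ltnW.
have qN0 N : (K <= N)%N -> q ^+ (N * N.+1) = 0.
  by move=> leKN; rewrite expK // (leq_trans leKN) // leq_pmulr.
have leK : (K <= (K + K).+1)%N by lia.
(* With L = 2K the indices L - N, for N < K, all lie beyond K. *)
have := bailey_lemma_fin (K + K) ab.
rewrite (sum_ord_trunc (F := fun N => q ^+ (N * N.+1) / qpoch q q (K + K - N) * beta N) leK);
  last by move=> N /qN0->; rewrite !mul0r.
rewrite (sum_ord_trunc (F := fun n => q ^+ (n * n.+1) * alpha n /
    qpoch q q (K + K - n) / qpoch q q (K + K + n).+1) leK);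
  last by move=> N /qN0->; rewrite !mul0r.
rewrite (eq_bigr (fun N : 'I_K => q ^+ (N * N.+1) * beta N / qpoch q q K)); last first.
  by move=> N _; rewrite (qpochK (K + K - N)%N) 1?mulrAC //; have := ltn_ord N; lia.
rewrite [RHS](eq_bigr (fun n : 'I_K => q ^+ (n * n.+1) * alpha n / qpoch q q K / qpoch q q K)).
  rewrite -!mulr_suml => E.
  have iq_unit : iq K \is a GRing.unit by rewrite unitrV.
  by rewrite (mulIr iq_unit E) mulrC divrK.
move=> n _; rewrite (qpochK (K + K - n)%N) ?(qpochK (K + K + n).+1) //; first by lia.
by have := ltn_ord n; lia.
Qed.

End Bailey.

(** * Partial fractions of a symmetric product *)

Section SymmetricProduct.

Variables (R : comUnitRingType) (q y : R).
Hypothesis q_unit : forall n, qpoch (q ^+ 2) (q ^+ 2) n \is a GRing.unit.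

Let S n := 1 - y * q ^+ n.*2.+1 + q ^+ n.*2.+1 ^+ 2.
Hypothesis S_unit : forall n, S n \is a GRing.unit.

(** With y = z + 1/z, the factor S n is (1 - z q^(2n+1)) (1 - q^(2n+1)/z), and
    the pair is the partial fraction expansion in z. The induction multiplies
    by S (N+1), which is q^(2(N+1-n)) S n plus a product that lowers both
    Pochhammer indices: the first part contributes the unit Bailey pair, which
    vanishes at N+1, and the second one the expansion for N. *)
Lemma symmetric_product_bailey_pair :
  bailey_pair (q ^+ 2)
    (fun n => (-1) ^+ n * q ^+ (n * n.+1) * (1 - q ^+ 2 ^+ n.*2.+1) / S n)
    (fun N => \prod_(k < N.+1) (S k)^-1).
Proof.
elim=> [|N IHN]; rewrite /bailey_pair.
  rewrite !big_ord1 /qpoch big_ord0 big_ord1 /= invr1.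
  by rewrite !expr0 !mulr1 !mul1r !expr1 mulrAC divrr ?mul1r // (unit_1subXS q_unit 0).
rewrite big_ord_recr /= IHN; apply: (mulIr (S_unit N.+1)); rewrite mulrVK //.
have := unit_bailey_pair q_unit N.+1 => /(congr1 (fun x => q ^+ 2 ^+ N.+1 * x)) /=.
rewrite mulr0 mulr_sumr => unit0.
pose v n := (-1) ^+ n * q ^+ (n * n.+1) * (1 - q ^+ 2 ^+ n.*2.+1) / S n
  * ((1 - q ^+ 2 ^+ (N.+1 - n)) / qpoch (q ^+ 2) (q ^+ 2) (N.+1 - n))
  * ((1 - q ^+ 2 ^+ (N.+1 + n).+1) / qpoch (q ^+ 2) (q ^+ 2) (N.+1 + n).+1).
transitivity (\sum_(n < N.+2) v n).
  have v0 : v N.+1 = 0 by rewrite /v subnn expr0 subrr mul0r mulr0 mul0r.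
  rewrite [RHS]big_ord_recr /= v0 addr0.
  apply: eq_bigr => -[n /= ltn] _; rewrite /v (subSn (ltn : n <= N)%N).
  by rewrite -(iqS q_unit (N - n)) -(iqS q_unit).
rewrite -[LHS]add0r {1}unit0 -big_split mulr_suml; apply: eq_bigr => -[n /= ltn] _.
have SE : S N.+1 = q ^+ 2 ^+ (N.+1 - n) * S n
          + (1 - q ^+ 2 ^+ (N.+1 - n)) * (1 - q ^+ 2 ^+ (N.+1 + n).+1).
  have -> : q ^+ 2 ^+ (N.+1 + n).+1 = q ^+ 2 ^+ (N.+1 - n) * q ^+ n.*2.+1 ^+ 2.
    by rewrite -!exprM -exprD; congr (_ ^+ _); lia.
  rewrite /S (_ : q ^+ N.+1.*2.+1 = q ^+ 2 ^+ (N.+1 - n) * q ^+ n.*2.+1); first by ring.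
  by rewrite -!exprM -!exprD; congr (_ ^+ _); lia.
have qE : q ^+ 2 ^+ N.+1 * q ^+ 2 ^+ 'C(n, 2) = q ^+ 2 ^+ (N.+1 - n) * q ^+ (n * n.+1).
  rewrite -!exprM -!exprD; congr (_ ^+ _).
  have : (n * n.-1 = 'C(n, 2).*2)%N by rewrite -mul2n -mul_bin_diag bin1.
  by nia.
transitivity (q ^+ 2 ^+ N.+1 * q ^+ 2 ^+ 'C(n, 2) * ((-1) ^+ n *  (1 - q ^+ 2 ^+ n.*2.+1)
   / qpoch (q ^+ 2) (q ^+ 2) (N.+1 - n) / qpoch (q ^+ 2) (q ^+ 2) (N.+1 + n).+1) + v n).
  by rewrite /=; ring.
have Sn : S n / S n = 1 by rewrite divrr.
by rewrite qE /v SE; ring: Sn.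
Qed.

End SymmetricProduct.

(** * Euler's pentagonal number theorem *)

Section Nilpotent.

Variables (R : comUnitRingType) (q : R) (K : nat).
Hypothesis qK0 : q ^+ K = 0.

Let Kgt0 : (0 < K)%N.
Proof. by case: K qK0 => // /eqP; rewrite expr0 oner_eq0. Qed.

Lemma qpoch_nil_unit n : qpoch q q n \is a GRing.unit.
Proof.
apply: rpred_prod => k _.
by rewrite -exprS (unitr_1subX (m := K)) // exprAC qK0 expr0n.
Qed.

(** Bailey's lemma for the unit pair, whose beta side reduces to the term 1. *)
Lemma pentagonal_nil : qpoch q q K =
  \sum_(n < K) (-1) ^+ n * q ^+ (n * n.+1 + 'C(n, 2)) * (1 - q ^+ n.*2.+1).
Proof.
have := bailey_lemma_nil qpoch_nil_unit qK0 (unit_bailey_pair qpoch_nil_unit).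
have -> : \sum_(N < K) q ^+ (N * N.+1) * (val N == 0%N)%:R = 1.
  by case: K Kgt0 => // k _; rewrite big_ord_recl big1 ?addr0 ?mul1r // => n _; rewrite mulr0.
rewrite mulr1 => ->.
by apply: eq_bigr => n _; rewrite exprD; ring.
Qed.

End Nilpotent.

(** * Triples of exponents *)

Definition zrange (K : nat) : seq int :=
  [seq Posz n | n <- index_iota 0 K] ++ [seq Negz n | n <- index_iota 0 K].

(** Twice a generalized pentagonal number: the base of the product is q^2. *)
Definition pent (k : int) : nat := `|(k * (3 * k + 1))%R|%N.

Lemma pentE k : (pent k)%:Z = k * (3 * k + 1).
Proof. by rewrite /pent; nia. Qed.

(** The exponents of (1 - x^2)/(1 + x + x^2) modulo 2, hence the extra 0. The
    bound 3K closes a block of three consecutive exponents, so that the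
    truncation error is a single power of x. *)
Definition nonmult3 K := [seq m <- iota 0 (3 * K).+1 | (m == 0)%N || ~~ (3 %| m)%N].

Definition triples K : seq (int * nat * nat) :=
  [seq (kn, m) | kn <- [seq (k, n) | k <- zrange K, n <- index_iota 0 K], m <- nonmult3 K].

Definition weight (x : int * nat * nat) : nat :=
  let: (k, n, m) := x in (pent k + 3 * (n * n.+1) + n.*2.+1 * m)%N.

Lemma mem_zrange K k : (k \in zrange K) = (- K%:Z <= k < K%:Z).
Proof.
rewrite mem_cat; case: k => n; last first.
  rewrite mem_map => [|? ? []//]; rewrite mem_index_iota.
  by case: mapP => [[]//|_] /=; lia.
rewrite (mem_map (f := Posz)) => [|? ? []//]; rewrite mem_index_iota.
by case: mapP => [[]//|_] /=; lia.
Qed.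

Lemma zrange_uniq K : uniq (zrange K).
Proof.
rewrite cat_uniq !map_inj_uniq ?iota_uniq /= ?andbT => [|? ? []//|? ? []//].
by apply/hasPn => _ /mapP[n _ ->]; apply/mapP => -[].
Qed.

Lemma leq_pent k : (`|k| <= pent k)%N.
Proof. by rewrite -lez_nat pentE; nia. Qed.

Lemma pent_inj : injective pent.
Proof.
move=> k l /(congr1 Posz); rewrite !pentE => E.
have : (k - l) * (3 * (k + l) + 1) = 0 by rewrite -[RHS](subrr (l * (3 * l + 1))) -{1}E; ring.
by move/eqP; rewrite mulf_eq0 => /orP[]/eqP; lia.
Qed.

Lemma pent_even k : (2 %| pent k)%N.
Proof.
have [a [kE|kE]] : exists a, k = 2 * a \/ k = 2 * a + 1 by exists (divz k 2); lia.
  have : (pent k)%:Z = 2 * (a * (6 * a + 1)) by rewrite pentE kE; ring.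
  by lia.
have : (pent k)%:Z = 2 * ((2 * a + 1) * (3 * a + 2)) by rewrite pentE kE; ring.
by lia.
Qed.

Lemma mem_triples K k n m : ((k, n, m) \in triples K) =
  [&& k \in zrange K, (n < K)%N & m \in nonmult3 K].
Proof.
apply/allpairsP/and3P => [|[kK nK mK]].
  move=> [[[k' n'] m'] /= [/allpairsP[[k1 n1] /= [kK nK [-> ->]]] mK [-> -> ->]]].
  by rewrite mem_index_iota in nK.
exists ((k, n), m); split=> //=; apply: (allpairs_f (fun k n => (k, n))) => //.
by rewrite mem_index_iota.
Qed.

Lemma triples_uniq K : uniq (triples K).
Proof.
apply: allpairs_uniq; last by move=> [? ?] [? ?].
- apply: allpairs_uniq; rewrite ?zrange_uniq ?iota_uniq //.
  by move=> [? ?] [? ?].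
- by rewrite filter_uniq ?iota_uniq.
Qed.

Lemma weightE k n m :
  (weight (k, n, m))%:Z = k * (3 * k + 1) + 3 * (n%:Z * (n%:Z + 1)) + (2 * n%:Z + 1) * m%:Z.
Proof. by have := pentE k; rewrite /weight; nia. Qed.

Lemma mem_weight_triples K N k n m : (N < K)%N -> (m == 0)%N || ~~ (3 %| m)%N ->
  weight (k, n, m) = N -> (k, n, m) \in triples K.
Proof.
move=> ltNK mP wE; rewrite mem_triples mem_zrange mem_filter mP mem_iota /=.
by have := leq_pent k; move: wE; rewrite /weight; nia.
Qed.

(** * The triples with positive last component *)

Lemma even_size_involution (T : eqType) (f : T -> T) (s : seq T) : uniq s ->
    (forall x, x \in s -> [/\ f x \in s, f (f x) = x & f x != x]) ->
  ~~ odd (size s).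
Proof.
have [n] := ubnP (size s); elim: n s => // n IHn [//|x s] /= lts /andP[xs us] fP.
have [] := fP x (mem_head _ _); rewrite inE => /orP[/eqP->|fxs ffx fx_x]; first by rewrite eqxx.
have s_gt0 : (0 < size s)%N by case: (s) fxs.
have := IHn (rem (f x) s); rewrite size_rem //= negbK -[in odd (size s)](prednK s_gt0) /= => -> //.
- by rewrite prednK //; lia.
- exact: rem_uniq.
move=> y; rewrite !mem_rem_uniq // !inE => /andP[y_fx ys].
have [] := fP y; first by rewrite inE ys orbT.
rewrite inE => /orP[/eqP fyx|fys ffy fy_y]; first by move=> ffy; rewrite -ffy fyx eqxx in y_fx.
split=> //; rewrite fys andbT; apply: contra xs => /eqP fyfx.
by rewrite -ffx -fyfx ffy.
Qed.

Lemma sqr_mod8 (x : int) : (exists y, x ^+ 2 = 4 * y) \/ (exists y, x ^+ 2 = 8 * y + 1).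
Proof.
have [a [->|->]] : exists a, x = 2 * a \/ x = 2 * a + 1.
- by exists (divz x 2); lia.
- by left; exists (a ^+ 2); ring.
right; have [b [->|->]] : exists b, a = 2 * b \/ a = 2 * b + 1 by exists (divz a 2); lia.
- by exists (2 * b ^+ 2 + b); ring.
by exists (2 * b ^+ 2 + 3 * b + 1); ring.
Qed.

(** Only divisibility by 3 is imposed: for N = 5 modulo 24 the equation itself
    makes g prime to 3, and one of u, t odd and the other 2 modulo 4. *)
Definition cone N (x : int * int * int) : bool :=
  let: (u, t, g) := x in
  [&& u ^+ 2 - t ^+ 2 + 2 * g ^+ 2 == N%:Z, (3 %| u)%Z, (3 %| t)%Z, t < g & 0 < u + t].

(** Flip u if both signs of u are in the cone; otherwise t, if both signs of t
    are; in the remaining region |g| < -t < u, and g can be flipped. Inside the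
    cone, |u| < t amounts to u < t and |t| < g to 0 < t + g. *)
Definition cone_flip (x : int * int * int) :=
  let: (u, t, g) := x in
  if u < t then (- u, t, g) else if 0 < t + g then (u, - t, g) else (u, t, - g).

(** A sign change fixes a point only if that coordinate is 0, and it is
    ill-defined only on the walls u = t and t = -g. The values of squares modulo
    8 exclude u = 0 and t = 0, parity excludes u = t, and g is prime to 3 while
    t is not, which excludes g = 0 and t = -g. *)
Lemma cone_flipP M x : cone (24 * M + 5) x ->
  [/\ cone (24 * M + 5) (cone_flip x), cone_flip (cone_flip x) = x & cone_flip x != x].
Proof.
case: x => [[u t] g] /and5P[/eqP E /dvdzP[u' uE] /dvdzP[t' tE] lttg ut_gt0].
have u0 : u != 0.
  apply/eqP => u0; move: E; rewrite u0.
  by case: (sqr_mod8 t) => -[y ->]; case: (sqr_mod8 g) => -[z ->]; lia.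
have t0 : t != 0.
  apply/eqP => t0; move: E; rewrite t0.
  by case: (sqr_mod8 u) => -[y ->]; case: (sqr_mod8 g) => -[z ->]; lia.
have ut : u != t by apply/eqP => ut; move: E; rewrite ut; lia.
have g3 g' : g != 3 * g'.
  by apply/eqP => gE; move: E; rewrite uE tE gE !exprMn; lia.
have g0 := g3 0; have tg := g3 (- t').
have dvd3N (y : int) : (3 %| - y)%Z = (3 %| y)%Z by lia.
have [u3 t3] : (3 %| u)%Z /\ (3 %| t)%Z by split; apply/dvdzP; [exists u'|exists t'].
rewrite /cone_flip; have [ltut|leut] := boolP (u < t).
  have -> : - u < t by lia.
  split; last by rewrite !xpair_eqE; lia.
    by rewrite /cone sqrrN E eqxx dvd3N u3 t3 lttg /=; lia.
  by rewrite opprK.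
have [tg0|tg0] := boolP (0 < t + g).
  have -> : (u < - t) = false by lia.
  have -> : 0 < - t + g by lia.
  split; last by rewrite !xpair_eqE; lia.
    by rewrite /cone sqrrN E eqxx dvd3N u3 t3 /=; lia.
  by rewrite opprK.
have -> : (0 < t - g) = false by lia.
rewrite (negPf leut); split; last by rewrite !xpair_eqE; lia.
  by rewrite /cone sqrrN E eqxx u3 t3 /=; lia.
by rewrite opprK.
Qed.

(** Putting B = 6k+1 and d = 2n+1, the weight equation reads
    B^2 + 9d^2 + 12dm = 48M + 10. With s = 1 for m = 1 modulo 3 and s = -1 for
    m = 2, the point is u = (3d + sB)/2 + m, g = (3d - sB)/2, t = g - m; this
    sign is the one that makes u and t divisible by 3. *)
Definition to_cone (x : int * nat * nat) : int * int * int :=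
  let: (k, n, m) := x in
  let e := if (m %% 3 == 1)%N then 3 * (n%:Z + k) + 2 else 3 * (n%:Z - k) + 1 in
  let g := if (m %% 3 == 1)%N then 3 * (n%:Z - k) + 1 else 3 * (n%:Z + k) + 2 in
  (e + m%:Z, g - m%:Z, g).

Lemma to_coneP M k n m : ~~ (3 %| m)%N ->
  cone (24 * M + 5) (to_cone (k, n, m)) = (weight (k, n, m) == 4 * M)%N.
Proof.
move=> m3; have := weightE k n m; rewrite /cone /to_cone.
case: ifP => m1 wE.
  have -> : (3 %| 3 * (n%:Z + k) + 2 + m%:Z)%Z by lia.
  have -> : (3 %| 3 * (n%:Z - k) + 1 - m%:Z)%Z by lia.
  by apply/and3P/eqP => [[/eqP]|] E; [|split]; lia.
have -> : (3 %| 3 * (n%:Z - k) + 1 + m%:Z)%Z by lia.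
have -> : (3 %| 3 * (n%:Z + k) + 2 - m%:Z)%Z by lia.
by apply/and3P/eqP => [[/eqP]|] E; [|split]; lia.
Qed.

Lemma to_cone_inj : {in [pred x : int * nat * nat | ~~ (3 %| x.2)%N] &, injective to_cone}.
Proof.
move=> [[k n] m] [[k' n'] m']; rewrite !inE /= => m3 m3' [].
have [m1|m1] := boolP (m %% 3 == 1)%N; have [m1'|m1'] := boolP (m' %% 3 == 1)%N => e1 e2 e3;
  try (have [-> -> ->] // : [/\ k = k', n = n' & m = m']; split; lia); by lia.
Qed.

(** Here m = g - t and 3(2n+1) = u + t are positive by the cone conditions, and
    u + t is odd because N is; the residue of g modulo 3 selects the branch. *)
Lemma to_cone_surj M y : cone (24 * M + 5) y ->
  exists2 x : int * nat * nat, ~~ (3 %| x.2)%N & to_cone x = y.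
Proof.
case: y => [[u t] g] /and5P[/eqP E /dvdzP[u' uE] /dvdzP[t' tE] lttg ut_gt0].
have [a [aE|aE]] : exists a, u' + t' = 2 * a \/ u' + t' = 2 * a + 1.
- by exists (divz (u' + t') 2); lia.
- have u'E : u' = 2 * a - t' by lia.
  have : 2 * (18 * (a * (a - t')) + g ^+ 2) = (24 * M + 5)%N%:Z.
    by rewrite -E uE tE u'E; ring.
  by lia.
have g3 g' : g != 3 * g'.
  by apply/eqP => gE; move: E; rewrite uE tE gE !exprMn; lia.
have [g' [gE|gE]] : exists g', g = 3 * g' + 1 \/ g = 3 * g' + 2.
  by exists (divz g 3); have := g3 (divz g 3); lia.
- exists (`|a|%N%:Z - g', `|a|%N, `|g - t|%N) => /=; first by lia.
  have -> : (`|g - t| %% 3 == 1)%N by lia.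
  by congr (_, _, _); lia.
exists (g' - `|a|%N%:Z, `|a|%N, `|g - t|%N) => /=; first by lia.
have -> : (`|g - t| %% 3 == 1)%N = false by lia.
by congr (_, _, _); lia.
Qed.

Lemma even_positive_triples K M : (4 * M < K)%N ->
  ~~ odd (count (fun x => (weight x == 4 * M)%N && (x.2 != 0)%N) (triples K)).
Proof.
move=> ltMK; rewrite -size_filter -(size_map to_cone); set s := filter _ _.
have sP x : (x \in s) = (weight x == 4 * M)%N && ~~ (3 %| x.2)%N.
  case: x => [[k n] m]; rewrite mem_filter /=.
  apply/andP/andP => [[/andP[-> m0]]|[/eqP wE m3]].
    by rewrite mem_triples mem_filter (negPf m0) => /and3P[_ _ /andP[]].
  rewrite wE eqxx (mem_weight_triples _ _ wE) ?m3 ?orbT //.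
  by split=> //; apply: contraNneq m3 => ->.
have memP y : (y \in map to_cone s) = cone (24 * M + 5) y.
  apply/mapP/idP => [[[[k n] m]]|Cy].
    by rewrite sP => /andP[wE m3] ->; rewrite to_coneP.
  have [[[k n] m] m3 xE] := to_cone_surj Cy; exists (k, n, m) => //.
  by rewrite sP -to_coneP // xE Cy.
apply: (even_size_involution (f := cone_flip)).
  rewrite map_inj_in_uniq ?filter_uniq ?triples_uniq // => x y.
  by rewrite !sP => /andP[_ x3] /andP[_ y3]; apply: to_cone_inj.
by move=> y; rewrite !memP; apply: cone_flipP.
Qed.

(** * The triples with zero last component *)

(** The identification of s and -s-1, which share the same s(s+1). *)
Definition fold_index (s : int) : nat :=
  match s with Posz n => n | Negz n => n end.

Lemma fold_indexE s : (fold_index s)%:Z = if 0 <= s then s else - s - 1.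
Proof. by case: s => n /=; lia. Qed.

(** The substitution k = 2b - a, s = a + 2b turns k(3k+1) + 3s(s+1) into
    2a(3a+1) + 8b(3b+1). Conversely exactly one of s = n and s = -n-1 has the
    parity of k, and divisibility by 4 of the weight then makes s + k a multiple
    of 4. *)
Lemma zero_triples K M : (4 * M < K)%N ->
  count (fun x => (weight x == 4 * M)%N && (x.2 == 0)%N) (triples K)
  = count (fun kl => 2 * pent kl.1 + 8 * pent kl.2 == 4 * M)%N
      [seq (k, l) | k <- zrange K, l <- zrange K].
Proof.
move=> ltMK; rewrite -!size_filter.
pose h (kl : int * int) : int * nat * nat :=
  (2 * kl.2 - kl.1, fold_index (kl.1 + 2 * kl.2), 0%N).
rewrite -(size_map h); apply/perm_size; rewrite perm_sym; apply: uniq_perm.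
- rewrite map_inj_uniq; last first.
    move=> [k l] [k' l'] [e1 /(congr1 Posz)]; rewrite !fold_indexE => e2.
    have [-> ->] // : k = k' /\ l = l'.
    by move: e1 e2 => /= e1; do 2!case: ifP => ?; move=> e2; split; lia.
  by rewrite filter_uniq // allpairs_uniq ?zrange_uniq // => -[? ?] [? ?].
- by rewrite filter_uniq // triples_uniq.
move=> [[k n] m]; rewrite mem_filter; apply/mapP/andP => [[[k' l']]|[/andP[/eqP wE /eqP/= m0] _]].
  rewrite mem_filter => /andP[/eqP E _] [-> nE ->].
  have wE : weight (2 * l' - k', n, 0%N) = (4 * M)%N.
    apply/eqP; rewrite -eqz_nat -E weightE nE fold_indexE /= PoszD !PoszM !pentE.
    by apply/eqP; case: ifP => _; ring.
  by split; [rewrite wE eqxx|apply: mem_weight_triples wE].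
move: wE => /(congr1 Posz); rewrite m0 weightE => wE.
have [a sn] : exists a, k + 2 * a = n%:Z \/ k + 2 * a = - n%:Z - 1.
  have [a [aE|aE]] : exists a, n%:Z = k + 2 * a \/ n%:Z = k + 2 * a + 1.
  - by exists (divz (n%:Z - k) 2); lia.
  - by exists a; left.
  - by exists (- k - a - 1); right; lia.
have {}wE : k * (3 * k + 1) + 3 * ((k + 2 * a) * (k + 2 * a + 1)) = (4 * M)%N.
  by rewrite -wE; case: sn => ->; ring.
have [b bE] : exists b, k + a = 2 * b.
  have [b [bE|bE]] : exists b, k + a = 2 * b \/ k + a = 2 * b + 1.
  - by exists (divz (k + a) 2); lia.
  - by exists b.
  have aE : a = 2 * b + 1 - k by lia.
  have [c [kE|kE]] : exists c, k = 2 * c \/ k = 2 * c + 1 by exists (divz k 2); lia.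
  - have : (4 * M)%N%:Z = 4 * (6 * c ^+ 2 - 7 * c - 12 * b * c + 12 * b ^+ 2 + 15 * b + 4) + 2.
      by rewrite -wE aE kE; ring.
    by lia.
  have : (4 * M)%N%:Z = 4 * (6 * c ^+ 2 - c - 12 * b * c + 12 * b ^+ 2 + 9 * b + 2) + 2.
    by rewrite -wE aE kE; ring.
  by lia.
have abE : (2 * pent a + 8 * pent b)%N = (4 * M)%N.
  have aE : a = 2 * b - k by lia.
  by apply/eqP; rewrite -eqz_nat -wE PoszD !PoszM !pentE aE; apply/eqP; ring.
exists (a, b).
  rewrite mem_filter abE eqxx /= (allpairs_f (fun k l => (k, l))) // mem_zrange.
    by have := leq_pent a; lia.
  by have := leq_pent b; lia.
rewrite /h /=; congr (_, _, _); first by lia.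
have -> : a + 2 * b = k + 2 * a by rewrite -bE; ring.
case: sn => -> //; apply/eqP; rewrite -eqz_nat fold_indexE.
by case: ifP => ?; apply/eqP; lia.
Qed.

(** * Watson's formula modulo 2 *)

Section ModTwo.

Variables (R : comUnitRingType) (q : R) (K : nat).
Hypothesis qK0 : q ^+ K = 0.
Hypothesis two0 : 2%:R = 0 :> R.

Let q2K0 : q ^+ 2 ^+ K = 0.
Proof. by rewrite exprAC qK0 expr0n. Qed.

Let oppr2 (x : R) : - x = x.
Proof. by rewrite -[LHS]add0r -(mul0r x) -two0; ring. Qed.

Let eq_mod2 (x y z : R) : x = y + 2%:R * z -> x = y.
Proof. by rewrite two0 mul0r addr0. Qed.

Let sign2 n : (-1) ^+ n = 1 :> R.
Proof. by rewrite oppr2 expr1n. Qed.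

Lemma pentagonal_mod2 :
  qpoch (q ^+ 2) (q ^+ 2) K = \sum_(k <- zrange K) q ^+ pent k.
Proof.
rewrite pentagonal_nil // big_cat !big_map !big_mkord /= -big_split /=.
apply: eq_bigr => -[n /= _] _; rewrite sign2 mul1r mulrBr mulr1 oppr2 -!exprM -exprD.
have : (n * n.-1 = 'C(n, 2).*2)%N by rewrite -mul2n -mul_bin_diag bin1.
by move=> binE; congr (_ ^+ _ + _ ^+ _); apply/eqP; rewrite -eqz_nat pentE; apply/eqP; nia.
Qed.

(** Each block x^(3n+1) + x^(3n+2) contributes x^(3n+1) (1 + x) (1 + x + x^2),
    that is x^(3n+1) + x^(3n+4) modulo 2, and these telescope. *)
Lemma sum_nonmult3 (x : R) : x ^+ K = 0 ->
  (1 + x + x ^+ 2) * (\sum_(m <- nonmult3 K) x ^+ m) = 1 + x ^+ 2.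
Proof.
move=> xK0; have partial n :
  (1 + x + x ^+ 2) * (\sum_(m <- nonmult3 n) x ^+ m) = 1 + x ^+ 2 + x ^+ (3 * n).+1.
  elim: n => [|n IHn]; first by rewrite big_seq1 expr0; ring.
  have -> : nonmult3 n.+1 = nonmult3 n ++ [:: (3 * n).+1; (3 * n).+2].
    rewrite /nonmult3 (_ : (3 * n.+1).+1 = (3 * n).+1 + 3)%N; last by lia.
    rewrite iotaD filter_cat add0n; congr (_ ++ _) => /=.
    have -> : (3 %| (3 * n).+1)%N = false by lia.
    have -> : (3 %| (3 * n).+2)%N = false by lia.
    by have -> : (3 %| (3 * n).+3)%N by lia.
  rewrite big_cat /= mulrDr IHn !big_cons big_nil addr0 mulnS.
  have -> : x ^+ (3 + 3 * n).+1 = x ^+ 3 * (x * x ^+ (3 * n)) by rewrite -exprS -exprD addnS.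
  have -> : x ^+ (3 * n).+2 = x * (x * x ^+ (3 * n)) by rewrite -!exprS.
  rewrite (exprS x (3 * n)).
  by apply: (eq_mod2 (z := (1 + x + x ^+ 2) * (x * x ^+ (3 * n)))); ring.
by rewrite partial (exprS x (3 * K)) (mulnC 3) exprM xK0 expr0n mulr0 addr0.
Qed.

(** Watson's formula (y = -1 in the symmetric product) multiplied by one more
    Euler product; on the left the square of that product is computed by the
    Frobenius map. *)
Lemma rho_mod2 :
  (\sum_(k <- zrange K) q ^+ (2 * pent k)) *
  (\sum_(N < K) q ^+ (2 * N * N.+1) *
     \prod_(k < N.+1) (1 + q ^+ k.*2.+1 + q ^+ k.*2.+1 ^+ 2)^-1)
  = \sum_(x <- triples K) q ^+ weight x.
Proof.
have S_unit n : 1 - -1 * q ^+ n.*2.+1 + q ^+ n.*2.+1 ^+ 2 \is a GRing.unit.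
  rewrite mulN1r opprK (unitr_1DXDX2 (m := K)) //.
  by rewrite exprAC qK0 expr0n.
have units := qpoch_nil_unit q2K0.
have := bailey_lemma_nil units q2K0 (symmetric_product_bailey_pair units S_unit).
move=> /(congr1 (fun x => qpoch (q ^+ 2) (q ^+ 2) K * x)); rewrite mulrA.
have -> : qpoch (q ^+ 2) (q ^+ 2) K * qpoch (q ^+ 2) (q ^+ 2) K
        = \sum_(k <- zrange K) q ^+ (2 * pent k).
  rewrite pentagonal_mod2 -expr2.
  elim: (zrange K) => [|k s IHs]; first by rewrite !big_nil expr0n.
  rewrite !big_cons -IHs (mulnC 2) exprM.
  by apply: (eq_mod2 (z := q ^+ pent k * \sum_(j <- s) q ^+ pent j)); ring.
rewrite /triples !big_allpairs pentagonal_mod2 => E.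
transitivity (\sum_(k <- zrange K) q ^+ pent k *
  (\sum_(n < K) q ^+ (3 * (n * n.+1)) * \sum_(m <- nonmult3 K) q ^+ n.*2.+1 ^+ m)); last first.
  apply: eq_bigr => k _; rewrite big_mkord mulr_sumr; apply: eq_bigr => n _.
  rewrite !mulr_sumr; apply: eq_bigr => m _.
  by rewrite -exprM mulrA -!exprD.
rewrite -mulr_suml; etransitivity; [etransitivity; [|exact: E]|]; congr (_ * _).
  apply: eq_bigr => N _; rewrite -exprM mulnA; congr (_ * _); apply: eq_bigr => k _.
  by congr (_^-1); ring.
apply: eq_bigr => n _; rewrite sign2 mul1r.
have xK0 : q ^+ n.*2.+1 ^+ K = 0 by rewrite exprAC qK0 expr0n.
have FE := sum_nonmult3 xK0.
apply: (mulIr (S_unit n)); rewrite mulrA divrK // oppr2 [in RHS]mulN1r opprK.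
rewrite -mulrA [X in _ = _ * X]mulrC FE mulrA -!exprM -!exprD (mulnC _ 2).
by congr (q ^+ _ * _); rewrite mulSn addnC.
Qed.

End ModTwo.

(** * Truncated power series *)

Section Truncation.

Variables (F : fieldType) (K : nat).
Hypothesis K_gt0 : (0 < K)%N.

Local Notation A := {poly %/ ('X^K : {poly F})}.
Local Notation inA := (in_qpoly ('X^K : {poly F})).

Let mk_monicXK : mk_monic ('X^K : {poly F}) = 'X^K.
Proof. by rewrite -(prednK K_gt0) mk_monic_Xn. Qed.

Lemma coef_in_qpolyXn (p : {poly F}) i : (i < K)%N -> (inA p)`_i = p`_i.
Proof.
move=> ltiK; rewrite [in RHS](Pdiv.RingMonic.rdivp_eq (monicXn F K) p).
by rewrite coefD coefMXn ltiK add0r /= mk_monicXK.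
Qed.

Lemma eq_in_qpolyXn (p r : {poly F}) :
  (forall i, (i < K)%N -> p`_i = r`_i) -> inA p = inA r.
Proof.
move=> eqpr; apply/npolyP => i; have [ltiK|leKi] := ltnP i K.
  by rewrite !coef_in_qpolyXn ?eqpr.
by rewrite !big_coef_npoly // mk_monicXK size_polyXn.
Qed.

Lemma in_qpolyXn_nil : inA 'X ^+ K = 0.
Proof.
rewrite -rmorphXn -(rmorph0 inA) /=; apply: eq_in_qpolyXn => i ltiK.
by rewrite coefXn coef0 ltn_eqF.
Qed.

Lemma coef_in_qpolyX_exp e i : (i < K)%N -> (inA 'X ^+ e)`_i = (i == e)%:R.
Proof. by move=> ltiK; rewrite -rmorphXn coef_in_qpolyXn ?coefXn. Qed.

Definition fps_trunc (f : fps int) : A := inA (\poly_(i < K) (f i)%:~R).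

Lemma fps_trunc_of_poly p : fps_trunc (fps_of_poly p) = inA (map_poly intr p).
Proof. by apply: eq_in_qpolyXn => i ltiK; rewrite coef_poly ltiK coef_map. Qed.

Lemma fps_truncM f g : fps_trunc (fps_mul f g) = fps_trunc f * fps_trunc g.
Proof.
rewrite -in_qpolyM; apply: eq_in_qpolyXn => i ltiK; rewrite coef_poly ltiK.
rewrite coefM rmorph_sum; apply: eq_bigr => -[j /= ltj] _.
by rewrite !coef_poly !ifT ?rmorphM //; lia.
Qed.

Lemma fps_truncV f : f 0%N \is a GRing.unit -> fps_trunc f * fps_trunc (fps_inv f) = 1.
Proof.
move=> f0; rewrite -fps_truncM -(rmorph1 inA); apply: eq_in_qpolyXn => i ltiK.
by rewrite coef_poly ltiK fps_mulV // coef1 rmorph_nat.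
Qed.

Lemma fps_trunc_sum (f : nat -> fps int) :
    (forall k n, (n < k)%N -> f k n = 0) ->
  fps_trunc (fps_sum f) = \sum_(k < K) fps_trunc (f k).
Proof.
move=> f0; rewrite -rmorph_sum; apply: eq_in_qpolyXn => i ltiK.
rewrite coef_poly ltiK -(fps_sum_limit f0 ltiK) rmorph_sum coef_sum.
by apply: eq_bigr => k _; rewrite coef_poly ltiK.
Qed.

Lemma fps_trunc_rho3 (q := inA 'X) : fps_trunc rho3 =
  \sum_(N < K) q ^+ (2 * N * N.+1) *
     \prod_(k < N.+1) (1 + q ^+ k.*2.+1 + q ^+ k.*2.+1 ^+ 2)^-1.
Proof.
have qK0 : q ^+ K = 0 := in_qpolyXn_nil.
have xK0 k : q ^+ k.*2.+1 ^+ K = 0 by rewrite exprAC qK0 expr0n.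
rewrite fps_trunc_sum; last exact: rho3_term_order.
apply: eq_bigr => N _; rewrite fps_truncM -(mulr1_eq (fps_truncV (rho3_denom_unit N))).
rewrite !fps_trunc_of_poly !rmorphM !rmorph_qpoch !rmorphXn /= !map_polyX -/q -mulrA.
congr (_ * _).
have denom_unit : qpoch (q ^+ 3) (q ^+ 6) N.+1 \is a GRing.unit.
  apply: rpred_prod => k _; rewrite -exprM -exprD (unitr_1subX (m := K)) //.
  by rewrite exprAC qK0 expr0n.
apply: (mulIr denom_unit); rewrite divrK // -big_split; apply: eq_bigr => k _ /=.
have -> : q * q ^+ 2 ^+ k = q ^+ k.*2.+1 by rewrite -exprM -exprS mul2n.
have -> : q ^+ 3 * q ^+ 6 ^+ k = q ^+ k.*2.+1 ^+ 3.
  by rewrite -!exprM -exprD; congr (_ ^+ _); lia.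
apply: (mulrI (unitr_1DXDX2 (xK0 k))); rewrite mulrA divrr ?(unitr_1DXDX2 (xK0 k)) //.
by ring.
Qed.

End Truncation.

(** * Coefficients of q^(4M) *)

Lemma intr_F2_eq0 (z : int) : (z%:~R == 0 :> 'F_2) = ~~ odd `|z|%N.
Proof.
have nat0 (n : nat) : (n%:R == 0 :> 'F_2) = ~~ odd n.
  by rewrite -(dvdn_pcharf (pchar_Fp (isT : prime 2))) dvdn2.
by case: z => n; rewrite ?NegzE ?mulrNz ?oppr_eq0 -pmulrn nat0 ?abszN.
Qed.

Lemma count_split (T : Type) (a b : pred T) s :
  count a s = (count (fun x => a x && b x) s + count (fun x => a x && ~~ b x) s)%N.
Proof. by elim: s => //= x s ->; case: (a x); case: (b x) => /=; lia. Qed.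

(** The coefficient of q^(4M) in Phi^2 rho, which determines the coefficients of
    rho at multiples of 4 recursively since pent k is even. *)
Lemma rho_recurrence M K : (4 * M < K)%N ->
  \sum_(k <- zrange K | (2 * pent k <= 4 * M)%N) (rho3 (4 * M - 2 * pent k)%N)%:~R
  = (count (fun kl => 2 * pent kl.1 + 8 * pent kl.2 == 4 * M)%N
      [seq (k, l) | k <- zrange K, l <- zrange K])%:R :> 'F_2.
Proof.
move=> ltMK; have K_gt0 : (0 < K)%N by lia.
pose h : {poly 'F_2} := 'X^K; pose q := in_qpoly h 'X.
have two0 : 2%:R = 0 :> {poly %/ h}.
  apply/npolyP => i; rewrite qpolyC_natr.
  have -> // : 2%:R = 0 :> {poly 'F_2}.
  by rewrite -polyC_natr -(polyC0 'F_2); congr _%:P; apply/val_inj.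
have := rho_mod2 (in_qpolyXn_nil _ K_gt0) two0.
rewrite -(fps_trunc_rho3 _ K_gt0) => /(congr1 (fun p : {poly %/ h} => p`_(4 * M))).
have coef_count (T : Type) (s : seq T) (w : T -> nat) :
    (\sum_(x <- s) q ^+ w x : {poly %/ h})`_(4 * M) = (count (fun x => w x == 4 * M)%N s)%:R.
  rewrite poly_of_qpoly_sum coef_sum -sum1_count natr_sum [RHS]big_mkcond.
  apply: eq_bigr => x _; rewrite coef_in_qpolyX_exp // eq_sym.
  by case: ifP.
rewrite coef_count.
have -> : (count (fun x => weight x == 4 * M)%N (triples K))%:R
  = (count (fun kl => 2 * pent kl.1 + 8 * pent kl.2 == 4 * M)%N
      [seq (k, l) | k <- zrange K, l <- zrange K])%:R :> 'F_2.
  rewrite -zero_triples // (count_split _ (fun x => x.2 == 0)%N) natrD.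
  have /negbTE := even_positive_triples ltMK; rewrite -[odd _]negbK -(intr_F2_eq0 (Posz _)).
  by rewrite -pmulrn => /negbFE/eqP->; rewrite addr0.
move=> <-; rewrite mulr_suml poly_of_qpoly_sum coef_sum [LHS]big_mkcond.
apply: eq_bigr => k _.
rewrite -rmorphXn -in_qpolyM coef_in_qpolyXn // coefXnM ltnNge coef_poly.
by case: ifP => // _; rewrite ifT //; lia.
Qed.

(** The right-hand side satisfies the same recurrence, whose term k = 0 is the
    unknown and whose other terms concern smaller multiples of 4. *)
Lemma rho3_mod2 M K : (4 * M < K)%N ->
  (rho3 (4 * M)%N)%:~R = (count (fun l => 8 * pent l == 4 * M)%N (zrange K))%:R :> 'F_2.
Proof.
elim/ltn_ind: M => M IHM ltMK; have := rho_recurrence ltMK.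
have -> : (count (fun kl => 2 * pent kl.1 + 8 * pent kl.2 == 4 * M)%N
      [seq (k, l) | k <- zrange K, l <- zrange K])%:R =
  \sum_(k <- zrange K | (2 * pent k <= 4 * M)%N)
    (count (fun l => 8 * pent l == 4 * M - 2 * pent k)%N (zrange K))%:R :> 'F_2.
  rewrite -sum1_count big_mkcond big_allpairs natr_sum [RHS]big_mkcond.
  apply: eq_bigr => k _; rewrite -big_mkcond sum1_count.
  case: ifP => le; first by congr _%:R; apply: eq_count => l /=; lia.
  by rewrite (eq_count (a2 := pred0)) ?count_pred0 // => l /=; lia.
have mem0 : 0 \in zrange K by rewrite mem_zrange; lia.
rewrite big_mkcond [RHS]big_mkcond !(bigD1_seq 0 mem0 (zrange_uniq K)) /= !subn0.
set A := \sum_(k <- _ | _) _; set B := \sum_(k <- _ | _) _.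
suff -> : A = B by apply: addIr.
apply: eq_bigr => k k_neq0; case: ifP => // lekM.
have pent_gt0 : (0 < pent k)%N by apply: leq_trans (leq_pent k); rewrite absz_gt0.
have /dvdnP[p pE] := pent_even k.
have -> : (4 * M - 2 * pent k = 4 * (M - p))%N by lia.
by apply: IHM; lia.
Qed.

Theorem theorem4p9 (n : nat) :
  odd `|rho3 (4 * n)%N|%N <-> exists k : int, n%:Z = 2 * k * (3 * k + 1).
Proof.
rewrite -[odd _]negbK -intr_F2_eq0 (rho3_mod2 (ltnSn (4 * n))).
set s := zrange _.
have s_uniq : uniq s := zrange_uniq _.
split=> [count_neq0|[k nE]].
  have /hasP[l _ /eqP lE] : has (fun l => 8 * pent l == 4 * n)%N s.
    by rewrite has_count lt0n; apply: contraNneq count_neq0 => ->.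
  by exists l; have := pentE l; lia.
have eq_count : count (fun l => 8 * pent l == 4 * n)%N s = count_mem k s.
  apply: eq_count => l /=; have kE : (4 * n = 8 * pent k)%N by have := pentE k; lia.
  by rewrite kE eqn_pmul2l // (inj_eq pent_inj).
rewrite eq_count count_uniq_mem // mem_zrange.
have -> // : - (4 * n).+1%:Z <= k < (4 * n).+1%:Z.
by have := leq_pent k; have := pentE k; lia.
Qed.
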